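(* For every positive integer $n$ and every real $x>0$ with $x\neq 1$, $$\biggl(\frac1{\ln x}\biggr)^{(n)}=\frac{(-1)^n}{x^n}\sum_{i=2}^{n+1}\frac{a_{n,i}}{(\ln x)^{i}},$$ where the left-hand side is the $n$-th derivative with respect to $x$, where $$a_{n,2}=(n-1)!,$$ and where, for $3\le i\le n+1$, $$a_{n,i}=(i-1)!\,(n-1)!\sum_{\ell_1=1}^{n-1} \frac1{\ell_1}\sum_{\ell_2=1}^{\ell_1-1}\frac1{\ell_2}\dotsm \sum_{\ell_{i-3}=1}^{\ell_{i-4}-1}\frac1{\ell_{i-3}} \sum_{\ell_{i-2}=1}^{\ell_{i-3}-1}\frac1{\ell_{i-2}}.$$
   Context: The expression for $a_{n,i}$ with $i\ge3$ is a nested sum of depth $i-2$ (so for $i=3$ it is $a_{n,3}=2!\,(n-1)!\sum_{\ell_1=1}^{n-1}\frac1{\ell_1}$). Empty sums are $0$. Equivalently, the nested sum is the sum of $\frac{1}{\ell_1\ell_2\cdots\ell_{i-2}}$ over all integers $n-1\ge \ell_1>\ell_2>\dots>\ell_{i-2}\ge1$. *)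

(* Defs.v *)
From Stdlib Require Import Reals Factorial.
From Coquelicot Require Import Coquelicot.
Open Scope R_scope.

(* [nested_sum k m] is the nested sum of depth [k] whose outermost index runs
   over 1..m and each further index over 1..(previous index - 1).  Depth 0 (an
   empty product) is 1, so the innermost summand is [/ l].  [sum_n_m f 1 0] is 0. *)
Fixpoint nested_sum (k m : nat) : R :=
  match k with
  | O => 1
  | S k' => sum_n_m (fun l : nat => / INR l * nested_sum k' (l - 1)) 1 m
  end.

(* Only meaningful for [1 <= n] and [2 <= i <= n + 1]. *)
Definition coef (n i : nat) : R :=
  if Nat.eqb i 2 then INR (fact (n - 1))
  else INR (fact (i - 1)) * INR (fact (n - 1)) * nested_sum (i - 2) (n - 1).

(* Main.v *)
(* Put w = 1 / ln x, so that w' = - w^2 / x.  Differentiating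
     (-1)^(m+1) m! / x^(m+1) * sum_j (j+1)! N(j,m) w^(j+2),
   where N(k,m) is the nested sum of depth k, reproduces the same shape for m + 1
   exactly because N(k+1,m+1) = N(k+1,m) + N(k,m) / (m+1). *)
Require Import Defs.
From Stdlib Require Import Reals.
From Coquelicot Require Import Coquelicot.
From Stdlib Require Import Factorial Lia Lra.
Open Scope R_scope.

Lemma nested_sum_recr (k m : nat) :
  nested_sum (S k) (S m) = nested_sum (S k) m + / INR (S m) * nested_sum k m.
Proof.
  simpl nested_sum.
  rewrite sum_n_Sm by lia.
  now replace (S m - 1)%nat with m by lia.
Qed.

(** No strictly decreasing chain of [k] indices fits into 1..m. *)
Lemma nested_sum_eq0 (k m : nat) : (m < k)%nat -> nested_sum k m = 0.
Proof.
  revert k; induction m as [|m IH]; intros [|k] Hmk; try lia.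
  - now simpl; rewrite sum_n_m_zero by lia.
  - rewrite nested_sum_recr, !IH by lia; ring.
Qed.

(** Here j stands for i - 2; the sign, [fact m] and the power of x wait for [inv_ln_derivative]. *)
Definition log_poly (m : nat) (w : R) : R :=
  sum_n (fun j => INR (fact (S j)) * nested_sum j m * w ^ (j + 2)) m.

Definition dlog_poly (m : nat) (w : R) : R :=
  sum_n (fun j => INR (fact (S (S j))) * nested_sum j m * w ^ (j + 1)) m.

Lemma is_derive_log_poly (m : nat) (w : R) :
  is_derive (log_poly m) w (dlog_poly m w).
Proof.
  apply (is_derive_sum_n
    (fun j w => INR (fact (S j)) * nested_sum j m * w ^ (j + 2))).
  intros j _.
  rewrite (fact_simpl (S j)), mult_INR.
  generalize (INR (fact (S j))); intros c.
  auto_derive; [easy|].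
  replace (pred (j + 2)) with (j + 1)%nat by lia.
  replace (j + 2)%nat with (S (S j)) by lia.
  ring.
Qed.

(** On the right, the first term comes from differentiating the power of x, the second from the
    chain rule. Multiplying by w^2 moves term j of [dlog_poly] to the degree of term j + 1 of
    [log_poly], with the same factorial. *)
Lemma log_poly_recr (m : nat) (w : R) :
  INR (S m) * log_poly (S m) w = INR (S m) * log_poly m w + w ^ 2 * dlog_poly m w.
Proof.
  assert (Hm : INR (S m) <> 0) by (apply not_0_INR; lia).
  set (a := fun j => INR (fact (S j)) * nested_sum j m * w ^ (j + 2)).
  (* A vanishing term at j = m + 1 is appended, so that splitting off j = 0 leaves m + 1 terms, as
     in [dlog_poly m]. *)
  assert (Hext : log_poly m w = a 0%nat + sum_n (fun j => a (S j)) m).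
  { assert (H0 : sum_n a (S m) = log_poly m w).
    { rewrite sum_Sn; unfold a at 2; rewrite nested_sum_eq0 by lia.
      rewrite Rmult_0_r, Rmult_0_l; apply (plus_zero_r (G := R_AbelianMonoid)). }
    rewrite <- H0; unfold sum_n.
    rewrite sum_Sn_m by lia; change plus with Rplus.
    now rewrite <- sum_n_m_S. }
  rewrite Hext; unfold log_poly, dlog_poly, sum_n.
  rewrite sum_Sn_m by lia; change plus with Rplus.
  rewrite <- sum_n_m_S.
  (* The j = 0 terms agree by computation: depth 0 gives 1 for any bound. *)
  rewrite !Rmult_plus_distr_l, Rplus_assoc; f_equal.
  rewrite <- !(sum_n_m_mult_l (K := R_Ring)).
  change mult with Rmult.
  rewrite <- (sum_n_m_plus (G := R_AbelianMonoid)).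
  apply sum_n_m_ext; intros j; unfold a.
  change plus with Rplus; change mult with Rmult.
  rewrite nested_sum_recr.
  replace (S j + 2)%nat with (2 + (j + 1))%nat by lia.
  rewrite pow_add.
  (* The equality is retyped from a structure's carrier to [R] for [field]. *)
  match goal with |- ?l = ?r => change (l = r :> R) end.
  field; exact Hm.
Qed.

Definition inv_ln_derivative (m : nat) (t : R) : R :=
  (-1) ^ S m * INR (fact m) * (/ t) ^ S m * log_poly m (/ ln t).

Lemma is_derive_inv_ln_derivative (m : nat) (x : R) : 0 < x -> ln x <> 0 ->
  is_derive (inv_ln_derivative m) x (inv_ln_derivative (S m) x).
Proof.
  intros Hx Hl; unfold inv_ln_derivative.
  pose proof (log_poly_recr m (/ ln x)) as Hrec.
  pose proof (is_derive_log_poly m (/ ln x)) as Hd.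
  auto_derive.
  - repeat split; try lra; try easy; now eexists; apply Hd.
  - change (Derive (fun w => log_poly m w)) with (Derive (log_poly m)).
    rewrite (is_derive_unique _ _ _ Hd).
    change (match m with O => 1 | S _ => INR m + 1 end) with (INR (S m)).
    rewrite fact_simpl, mult_INR.
    (* The factor [INR (S m)] freed from the factorial joins [log_poly (S m)] to form the left side
       of [Hrec]. *)
    replace ((-1) ^ S (S m) * (INR (S m) * INR (fact m)) * (/ x) ^ S (S m)
             * log_poly (S m) (/ ln x))
      with ((-1) ^ S (S m) * INR (fact m) * (/ x) ^ S (S m)
             * (INR (S m) * log_poly (S m) (/ ln x))) by ring.
    rewrite Hrec; change (pred (S m)) with m.
    rewrite <- !tech_pow_Rmult; field; lra.
Qed.

Lemma ln_neq0 (x : R) : 0 < x -> x <> 1 -> ln x <> 0.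
Proof.
  intros Hx Hx1 H; apply Hx1, ln_inv; [lra..|now rewrite ln_1].
Qed.

Lemma is_derive_n_inv_ln (m : nat) (x : R) : 0 < x -> x <> 1 ->
  is_derive_n (fun t => 1 / ln t) (S m) x (inv_ln_derivative m x).
Proof.
  revert x; induction m as [|m IH]; intros x Hx Hx1;
    pose proof (ln_neq0 x Hx Hx1) as Hl.
  - unfold inv_ln_derivative, log_poly; rewrite sum_O; simpl.
    auto_derive; [easy|field; lra].
  - apply (is_derive_ext_loc (inv_ln_derivative m)).
    (* The induction hypothesis is needed on a neighbourhood of x, and its two conditions on t are
       open. *)
    + apply (locally_open (fun t => 0 < t /\ t <> 1)); [| |easy].
      * apply open_and; [apply open_gt|apply open_neq].
      * now intros t [Ht Ht1]; symmetry; apply is_derive_n_unique, IH.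
    + now apply is_derive_inv_ln_derivative.
Qed.

Lemma coefE (m j : nat) :
  coef (S m) (j + 2) = INR (fact m) * (INR (fact (S j)) * nested_sum j m).
Proof.
  unfold coef.
  replace (S m - 1)%nat with m by lia.
  replace (j + 2 - 1)%nat with (S j) by lia.
  replace (j + 2 - 2)%nat with j by lia.
  destruct (Nat.eqb_spec (j + 2) 2) as [E|_]; [|ring].
  (* The separate case i = 2 fits the general formula, as 1! and the depth 0 sum are both 1. *)
  replace j with 0%nat by lia; simpl; ring.
Qed.

Theorem theorem2p1 (n : nat) (x : R) (hn : (1 <= n)%nat) (hx0 : 0 < x) (hx1 : x <> 1) :
  is_derive_n (fun t : R => 1 / ln t) n x
    ((-1) ^ n / x ^ n * sum_n_m (fun i : nat => coef n i / (ln x) ^ i) 2 (n + 1)).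
Proof.
  destruct n as [|m]; [lia|].
  replace (_ * sum_n_m _ _ _) with (inv_ln_derivative m x);
    [now apply is_derive_n_inv_ln|].
  replace (S m + 1)%nat with (S (S m)) by lia.
  (* Two unit shifts, i = j + 2, bring the range 2..m+2 to 0..m. *)
  rewrite <- !sum_n_m_S.
  unfold inv_ln_derivative, log_poly.
  rewrite (sum_n_m_ext _ (fun j => mult (INR (fact m))
    (INR (fact (S j)) * nested_sum j m * (/ ln x) ^ (j + 2)))).
  - rewrite (sum_n_m_mult_l (K := R_Ring)); change mult with Rmult.
    rewrite pow_inv, <- Rmult_assoc; unfold Rdiv.
    apply (f_equal2 Rmult); [ring|easy].
  - intros j; replace (S (S j)) with (j + 2)%nat by lia.
    rewrite coefE, pow_inv; apply Rmult_assoc.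
Qed.
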